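(* For any bipartite quantum state $\rho_{AB}$, we have $I_{\max}^{\mathrm{acc}}(B;A)_\rho\le H_0(A)_\rho$.
   Context: All registers are finite-dimensional quantum systems; $\rho_A,\rho_B$ are the reduced states. $H_0(A)_\rho:=\log_2(\mathrm{rank}(\rho_A))$. $X\le Y$ means that $Y-X$ is positive semidefinite. A measurement on $A$ with outcome register $X$ is a CPTP map $\mathcal M_{A\to X}$ of the form $\mathcal M(\rho_A)=\sum_{x}\mathrm{tr}(M_x\rho_A)\,|x\rangle\langle x|_X$, where $\{M_x\}_x$ is a POVM on $A$ (finite outcome set) and $\{|x\rangle\}$ is a fixed orthonormal basis of $\mathcal H_X$; applied to $\rho_{AB}$ it acts as the identity on $B$. $I_{\max}^{\mathrm{acc}}(B;A)_\rho$ is the smallest real number such that for every measurement $\mathcal M_{A\to X}$ there exists a density operator $\sigma_X$, of the form $\sigma_X=\sum_x\lambda_x|x\rangle\langle x|$ with $\{\lambda_x\}$ a probability distribution, with $\mathcal M(\rho_{AB})\le 2^{I_{\max}^{\mathrm{acc}}(B;A)_\rho}\,\sigma_X\otimes\rho_B$. *)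

(* Defs.v *)
From HB Require Import structures.
From mathcomp Require Export all_boot all_order all_algebra.
From mathcomp Require Export sesquilinear spectral.
From mathcomp Require Export complex mxtens.
From mathcomp Require Export classical_sets reals exp.

Set Implicit Arguments.
Unset Strict Implicit.
Unset Printing Implicit Defensive.

Import Order.TTheory GRing.Theory Num.Theory.

Local Open Scope ring_scope.
Local Open Scope complex_scope.
Local Open Scope sesquilinear_scope.

Section Definitions.
Variable R : realType.
Local Notation C := R[i].

Definition psdmx n (X : 'M[C]_n) : Prop :=
  X \is hermsymmx /\ forall v : 'cV[C]_n, 0 <= (v ^t* *m X *m v) 0 0.

Definition lemx n (X Y : 'M[C]_n) : Prop := psdmx (Y - X).

Definition density n (rho : 'M[C]_n) : Prop := psdmx rho /\ \tr rho = 1.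

(* Operators on C^a (x) C^b are indexed by mxtens_index (k, i), with k the
   index of the first factor and i that of the second, as in tensmx. *)

(* Tr_B rho_AB, the reduced operator on A. *)
Definition reducedA a b (rho : 'M[C]_(a * b)) : 'M[C]_a :=
  \matrix_(k, l) \sum_(i < b) rho (mxtens_index (k, i)) (mxtens_index (l, i)).

(* Tr_A rho_AB, the reduced operator on B. *)
Definition reducedB a b (rho : 'M[C]_(a * b)) : 'M[C]_b :=
  \matrix_(i, j) \sum_(k < a) rho (mxtens_index (k, i)) (mxtens_index (k, j)).

(* The operators blockB rho i j on A are the coefficients in
   rho = \sum_(i, j) blockB rho i j (x) |i><j|. *)
Definition blockB a b (rho : 'M[C]_(a * b)) (i j : 'I_b) : 'M[C]_a :=
  \matrix_(k, l) rho (mxtens_index (k, i)) (mxtens_index (l, j)).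

(* (Phi (x) id_B) rho, for a linear map Phi. *)
Definition apply_on_A a b n (Phi : 'M[C]_a -> 'M[C]_n) (rho : 'M[C]_(a * b)) :
    'M[C]_(n * b) :=
  \sum_(i < b) \sum_(j < b) tensmx (Phi (blockB rho i j)) (delta_mx i j).

Definition povm a n (M : 'I_n -> 'M[C]_a) : Prop :=
  (forall x, psdmx (M x)) /\ \sum_(x < n) M x = 1%:M.

(* delta_mx x x is |x><x|, for the standard basis of C^n. *)
Definition measure a n (M : 'I_n -> 'M[C]_a) (A : 'M[C]_a) : 'M[C]_n :=
  \sum_(x < n) \tr (M x *m A) *: delta_mx x x.

Definition prob_dist n (lambda : 'I_n -> R) : Prop :=
  (forall x, 0 <= lambda x) /\ \sum_(x < n) lambda x = 1.

Definition classical_state n (sigma : 'M[C]_n) : Prop :=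
  exists lambda : 'I_n -> R, prob_dist lambda /\
    sigma = \sum_(x < n) (lambda x)%:C *: delta_mx x x.

Definition acc_bound a b (rho : 'M[C]_(a * b)) (r : R) : Prop :=
  forall (n : nat) (M : 'I_n -> 'M[C]_a), povm M ->
    exists sigma : 'M[C]_n, classical_state sigma /\
      lemx (apply_on_A (measure M) rho)
           ((2 `^ r)%:C *: tensmx sigma (reducedB rho)).

(* I is the value of I_max^acc(B;A)_rho. *)
Definition is_Imax_acc a b (rho : 'M[C]_(a * b)) (I : R) : Prop :=
  acc_bound rho I /\ forall r : R, acc_bound rho r -> I <= r.

(* H_0(A)_rho *)
Definition H0 a b (rho : 'M[C]_(a * b)) : R :=
  ln ((\rank (reducedA rho))%:R) / ln 2.

End Definitions.

(* Main.v *)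
(** Write T_x = tr_A ((M_x (x) 1) rho).  The measured state is block diagonal
    with blocks T_x, so r is admissible for the POVM M iff there are weights
    with T_x <= 2^r lambda_x rho_B, that is iff the sum of the least c_x with
    T_x <= c_x rho_B is at most 2^r.  Hence the admissible r form a closed
    half-line.  It is bounded below since taking traces gives sum_x c_x >= 1.
    If P is the support projector of rho_A, then rho is fixed by P (x) 1, and
    tr(N S) <= tr N tr S for positive semidefinite N, S, applied to N = P M_x P,
    gives c_x <= tr(P M_x); these sum to tr P = rank rho_A. *)
Require Import Defs.
From mathcomp Require Import ring.
Import Order.TTheory GRing.Theory Num.Theory.
Local Open Scope ring_scope.
Local Open Scope complex_scope.
Local Open Scope sesquilinear_scope.

(** * Positive semidefinite matrices: spectral form, traces, support projector *)

Section Psd.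
Set Implicit Arguments.
Unset Strict Implicit.
Variable R : realType.
Local Notation C := R[i].

Lemma hermsymmxP n (X : 'M[C]_n) : reflect (X^t* = X) (X \is hermsymmx).
Proof.
by apply: (iffP (is_hermitianmxP _ _ _)) => h; [rewrite {2}h|rewrite h]; rewrite expr0 scale1r.
Qed.

Lemma trmxC_mul m n p (A : 'M[C]_(m, n)) (B : 'M[C]_(n, p)) :
  (A *m B)^t* = B^t* *m A^t*.
Proof. by rewrite trmx_mul map_mxM. Qed.

Lemma psdmx0 n : psdmx (0 : 'M[C]_n).
Proof.
split; first by apply/hermsymmxP; rewrite trmx0 map_mx0.
by move=> v; rewrite mulmx0 mul0mx mxE.
Qed.

Lemma psdmxD n (X Y : 'M[C]_n) : psdmx X -> psdmx Y -> psdmx (X + Y).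
Proof.
move=> [/hermsymmxP hX pX] [/hermsymmxP hY pY]; split.
  by apply/hermsymmxP; rewrite linearD /= map_mxD hX hY.
by move=> v; rewrite mulmxDr mulmxDl mxE addr_ge0.
Qed.

Lemma psdmx_sum n (I : finType) (X : I -> 'M[C]_n) :
  (forall i, psdmx (X i)) -> psdmx (\sum_i X i).
Proof.
move=> hX; elim/big_ind: _ => //; first exact: psdmx0.
by move=> *; apply: psdmxD.
Qed.

Lemma psdmxZ n (c : C) (X : 'M[C]_n) : 0 <= c -> psdmx X -> psdmx (c *: X).
Proof.
move=> c0 [/hermsymmxP hX pX]; split.
  apply/hermsymmxP; rewrite linearZ /= map_mxZ hX.
  by congr (_ *: _); apply/CrealP; apply: ger0_real.
by move=> v; rewrite -scalemxAr -scalemxAl mxE mulr_ge0.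
Qed.

Lemma psdmx_conj m n (B : 'M[C]_(n, m)) (X : 'M[C]_n) :
  psdmx X -> psdmx (B^t* *m X *m B).
Proof.
move=> [/hermsymmxP hX pX]; split.
  by apply/hermsymmxP; rewrite !trmxC_mul hX trmxCK mulmxA.
by move=> v; move: (pX (B *m v)); rewrite trmxC_mul !mulmxA.
Qed.

Lemma psdmx1 n : psdmx (1%:M : 'M[C]_n).
Proof.
split; first exact: hermitian1mx_subproof.
move=> v; rewrite mulmx1 mxE sumr_ge0 // => i _.
by rewrite !mxE mulrC mul_conjC_ge0.
Qed.

Lemma psdmx_diag_ge0 n (X : 'M[C]_n) i : psdmx X -> 0 <= X i i.
Proof.
case=> _ /(_ (delta_mx i 0)).
rewrite trmx_delta map_delta_mx -rowE mxE (bigD1 i) //= !mxE !eqxx mulr1.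
by rewrite big1 ?addr0 // => j ji; rewrite !mxE (negbTE ji) mulr0.
Qed.

Lemma psdmx_trace_ge0 n (X : 'M[C]_n) : psdmx X -> 0 <= \tr X.
Proof. by move=> hX; apply: sumr_ge0 => i _; apply: psdmx_diag_ge0. Qed.

Lemma psdmx_spectral n (X : 'M[C]_n) : psdmx X ->
  exists (U : 'M[C]_n) (d : 'rV[C]_n),
    [/\ U^t* *m U = 1%:M, forall k, 0 <= d 0 k & X = U^t* *m diag_mx d *m U].
Proof.
move=> pX; have uU := spectral_unitarymx X.
have hX := orthomx_spectralP (hermitian_normalmx pX.1); rewrite invmx_unitary // in hX.
exists (spectralmx X), (spectral_diag X).
set U := spectralmx X in uU hX *; set d := spectral_diag X in hX *.
have UU : U *m U^t* = 1%:M by apply/unitarymxP.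
split=> //; first exact: mulmx1C.
(* The eigenvalue [d 0 k] is the k-th diagonal entry of U X U^*, which is positive semidefinite. *)
move=> k; have := psdmx_diag_ge0 k (psdmx_conj (U^t*) pX).
by rewrite hX trmxCK !mulmxA UU mul1mx -mulmxA UU mulmx1 mxE eqxx mulr1n.
Qed.

(** In an eigenbasis of [M] the trace is a sum of eigenvalues of [M] times diagonal entries of the
    rotated [S]; each such entry lies between 0 and the trace of [S]. *)
Lemma psdmx_trace_mul n (M S : 'M[C]_n) : psdmx M -> psdmx S ->
  0 <= \tr (M *m S) <= \tr M * \tr S.
Proof.
move=> /psdmx_spectral [U [d [UU d0 ->]]] pS.
have pT : psdmx (U *m S *m U^t*).
  by have := psdmx_conj (U^t*) pS; rewrite trmxCK.
have -> : \tr (U^t* *m diag_mx d *m U *m S) = \sum_k d 0 k * (U *m S *m U^t*) k k.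
  rewrite -!mulmxA mxtrace_mulC -!mulmxA mxtrace_mulC mulmxA.
  by rewrite mxtrace_mulC mul_diag_mx; apply: eq_bigr => k _; rewrite mxE.
have -> : \tr (U^t* *m diag_mx d *m U) = \sum_k d 0 k.
  by rewrite mxtrace_mulC mulmxA (mulmx1C UU) mul1mx mxtrace_diag.
have -> : \tr S = \tr (U *m S *m U^t*).
  by rewrite mxtrace_mulC mulmxA UU mul1mx.
apply/andP; split.
  by apply: sumr_ge0 => k _; rewrite mulr_ge0 // psdmx_diag_ge0.
rewrite mulr_suml; apply: ler_sum => k _; rewrite ler_wpM2l //.
rewrite /mxtrace (bigD1 k) //= lerDl sumr_ge0 // => l _.
exact: psdmx_diag_ge0.
Qed.

Lemma trace_gram_eq0 m n (G : 'M[C]_(m, n)) : \tr (G^t* *m G) = 0 -> G = 0.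
Proof.
have e j : (G^t* *m G) j j = \sum_i `|G i j| ^+ 2.
  by rewrite mxE; apply: eq_bigr => i _; rewrite !mxE mulrC normCK.
rewrite /mxtrace => h; apply/matrixP => i j; rewrite mxE.
have h1 : (G^t* *m G) j j = 0.
  apply: (psumr_eq0P _ h) => // k _.
  by rewrite e sumr_ge0 // => l _; rewrite exprn_ge0.
have := h1; rewrite e => h2.
have : `|G i j| ^+ 2 = 0.
  by apply: (psumr_eq0P _ h2) => // l _; rewrite exprn_ge0.
by move/eqP; rewrite sqrf_eq0 normr_eq0 => /eqP.
Qed.

Lemma psdmx_gram n (X : 'M[C]_n) : psdmx X -> exists G : 'M[C]_n, X = G^t* *m G.
Proof.
move=> /psdmx_spectral [U [d [_ d0 ->]]].
pose s := map_mx sqrtC d; exists (diag_mx s *m U).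
suff -> : diag_mx d = (diag_mx s)^t* *m diag_mx s by rewrite trmxC_mul !mulmxA.
rewrite tr_diag_mx map_diag_mx mulmx_diag; congr diag_mx.
apply/rowP => k; rewrite !mxE -[LHS]sqrtCK expr2; congr (_ * _).
by apply/esym/CrealP/ger0_real; rewrite sqrtC_ge0.
Qed.

(** Writing [X] as G^* G turns the trace into the squared Hilbert-Schmidt norm of G B, so G B
    vanishes. *)
Lemma psdmx_mul_eq0 m n (X : 'M[C]_n) (B : 'M[C]_(n, m)) :
  psdmx X -> \tr (B^t* *m X *m B) = 0 -> X *m B = 0.
Proof.
move=> /psdmx_gram [G ->] h.
have /trace_gram_eq0 GB : \tr ((G *m B)^t* *m (G *m B)) = 0.
  by rewrite -h trmxC_mul !mulmxA.
by rewrite -mulmxA GB mulmx0.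
Qed.

(* The projector onto the row space of X, with orthonormal rows obtained by the
   Gram-Schmidt process. *)
Lemma support_proj n (X : 'M[C]_n) :
  exists P : 'M[C]_n, [/\ P^t* = P, P *m P = P, X *m P = X & \tr P = (\rank X)%:R].
Proof.
pose Q := schmidt (row_base X).
have QQ : Q *m Q^t* = 1%:M by apply/unitarymxP/schmidt_unitarymx/rank_leq_col.
have XQ : (X <= Q)%MS.
  by apply: submx_trans (schmidt_sub _); rewrite eq_row_base.
exists (Q^t* *m Q); split.
- by rewrite trmxC_mul trmxCK.
- by rewrite mulmxA -(mulmxA _ Q) QQ mulmx1.
- by rewrite -{1}(mulmxKpV XQ) mulmxA -(mulmxA _ Q) QQ mulmx1 mulmxKpV.
- by rewrite mxtrace_mulC QQ mxtrace1.
Qed.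

End Psd.

(** * Slices of a bipartite operator and the bound on outcome operators *)

Section Bipartite.
Set Implicit Arguments.
Unset Strict Implicit.
Variables (R : realType) (a b : nat) (rho : 'M[R[i]]_(a * b)).
Local Notation C := R[i].

Lemma sum_mxtens_index (m n : nat) (F : 'I_(m * n) -> C) :
  \sum_s F s = \sum_(k < m) \sum_(i < n) F (mxtens_index (k, i)).
Proof.
rewrite pair_bigA /= (reindex (@mxtens_index m n)) /=; last first.
  by exists (@mxtens_unindex m n) => s _; rewrite ?mxtens_indexK ?mxtens_unindexK.
by apply: eq_bigr => -[].
Qed.

(* The matrix of w |-> w (x) v. *)
Definition tens_vec (v : 'cV[C]_b) : 'M[C]_(a * b, a) :=
  \matrix_(s, l) (((mxtens_unindex s).1 == l)%:R * v (mxtens_unindex s).2 0).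

(* (1 (x) <v|) rho (1 (x) |v>) *)
Definition slice (v : 'cV[C]_b) : 'M[C]_a := (tens_vec v)^t* *m rho *m tens_vec v.

(* tr_A ((M (x) 1) rho) *)
Definition outcomeB (M : 'M[C]_a) : 'M[C]_b :=
  \matrix_(i, j) \tr (M *m blockB rho i j).

Lemma sliceE v :
  slice v = \sum_i \sum_j ((v i 0)^* * v j 0)%R *: blockB rho i j.
Proof.
apply/matrixP => k l; rewrite /slice mxE sum_mxtens_index (bigD1 l) //=.
rewrite [X in _ + X]big1 ?addr0; last first.
  by move=> k' /negbTE k'l; apply: big1 => j _; rewrite !mxE mxtens_indexK /= k'l mul0r mulr0.
rewrite summxE.
under [RHS]eq_bigr => i _ do rewrite summxE.
rewrite exchange_big /=; apply: eq_bigr => j _; rewrite !mxE mxtens_indexK /= eqxx mul1r.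
rewrite sum_mxtens_index (bigD1 k) //= [X in _ + X]big1 ?addr0; last first.
  move=> k' /negbTE k'k; apply: big1 => i _.
  by rewrite !mxE mxtens_indexK /= k'k mul0r conjC0 mul0r.
rewrite mulr_suml; apply: eq_bigr => i _.
by rewrite !mxE mxtens_indexK /= eqxx mul1r mulrAC.
Qed.

Lemma slice_delta i : slice (delta_mx i 0) = blockB rho i i.
Proof.
rewrite sliceE (bigD1 i) //= [X in _ + X]big1 ?addr0; last first.
  by move=> k /negbTE ki; apply: big1 => j _; rewrite !mxE ki conjC0 mul0r scale0r.
rewrite (bigD1 i) //= [X in _ + X]big1 ?addr0; last first.
  by move=> k /negbTE ki; rewrite !mxE ki mulr0 scale0r.
by rewrite !mxE !eqxx conjC1 mulr1 scale1r.
Qed.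

Lemma reducedA_slice : reducedA rho = \sum_i slice (delta_mx i 0).
Proof.
apply/matrixP => k l; rewrite summxE mxE; apply: eq_bigr => i _.
by rewrite slice_delta mxE.
Qed.

Lemma reducedB_outcomeB : reducedB rho = outcomeB 1%:M.
Proof.
by apply/matrixP => i j; rewrite !mxE mul1mx; apply: eq_bigr => k _; rewrite mxE.
Qed.

Lemma outcomeB_sum n (M : 'I_n -> 'M[C]_a) :
  \sum_x outcomeB (M x) = outcomeB (\sum_x M x).
Proof.
apply/matrixP => i j; rewrite summxE !mxE mulmx_suml raddf_sum.
by apply: eq_bigr => x _; rewrite mxE.
Qed.

(** This moves the operator order on B to traces on A: inequalities between outcome operators are
    checked for each [v] by pairing with the positive operator [slice v]. *)
Lemma outcomeB_form M v : (v^t* *m outcomeB M *m v) 0 0 = \tr (M *m slice v).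
Proof.
rewrite sliceE mulmx_sumr raddf_sum /= [LHS]mxE.
under [LHS]eq_bigr => j _ do rewrite mxE mulr_suml.
rewrite exchange_big /=; apply: eq_bigr => i _.
rewrite mulmx_sumr raddf_sum /=; apply: eq_bigr => j _.
by rewrite -scalemxAr mxtraceZ !mxE mulrAC.
Qed.

Hypothesis rho_psd : psdmx rho.

Lemma psdmx_slice v : psdmx (slice v).
Proof. exact: psdmx_conj. Qed.

Lemma blockB_adjoint i j : (blockB rho i j)^t* = blockB rho j i.
Proof.
have /hermsymmxP h := rho_psd.1.
by apply/matrixP => k l; rewrite !mxE -[in RHS]h !mxE.
Qed.

Lemma psdmx_outcomeB M : psdmx M -> psdmx (outcomeB M).
Proof.
move=> pM; split; last first.
  by move=> v; rewrite outcomeB_form; case/andP: (psdmx_trace_mul pM (psdmx_slice v)).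
have /hermsymmxP hM := pM.1.
apply/hermsymmxP/matrixP => i j; rewrite !mxE.
rewrite -[in RHS]hM -(blockB_adjoint j i) [RHS]mxtrace_mulC.
by rewrite -trmxC_mul trace_map_mx mxtrace_tr.
Qed.

Lemma trace_reducedB : \tr (reducedB rho) = \tr rho.
Proof.
rewrite [RHS]/mxtrace sum_mxtens_index exchange_big; apply: eq_bigr => k _.
by rewrite mxE.
Qed.

(** The trace of Q^* rho_A Q is a sum of nonnegative terms, one per basis vector of B. Each term
    vanishes, so [rho] kills the range of Q tensored with any basis vector; linearity of [tens_vec]
    extends this to [v]. *)
Lemma slice_kernel m (Q : 'M[C]_(a, m)) v :
  reducedA rho *m Q = 0 -> slice v *m Q = 0.
Proof.
move=> hQ.
have h i : rho *m (tens_vec (delta_mx i 0) *m Q) = 0.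
  apply: psdmx_mul_eq0 => //.
  have e k : \tr ((tens_vec (delta_mx k 0) *m Q)^t* *m rho *m (tens_vec (delta_mx k 0) *m Q))
      = \tr (Q^t* *m slice (delta_mx k 0) *m Q).
    by rewrite trmxC_mul !mulmxA.
  rewrite e.
  have h0 : \sum_k \tr (Q^t* *m slice (delta_mx k 0) *m Q) = 0.
    rewrite -raddf_sum /= -mulmx_suml -mulmx_sumr -reducedA_slice -mulmxA hQ.
    by rewrite mulmx0 mxtrace0.
  apply: (psumr_eq0P _ h0) => // k _.
  by apply/psdmx_trace_ge0/psdmx_conj/psdmx_slice.
have -> : slice v = (tens_vec v)^t* *m rho *m \sum_i v i 0 *: tens_vec (delta_mx i 0).
  congr (_ *m _); apply/matrixP => s l; rewrite !mxE summxE.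
  rewrite (bigD1 (mxtens_unindex s).2) // big1 => [|i /negbTE ni].
    by rewrite !mxE !eqxx /= mulr1 addr0 mulrC.
  by rewrite !mxE [_ == i]eq_sym ni !mulr0.
rewrite -!mulmxA mulmx_suml mulmx_sumr.
rewrite big1 ?mulmx0 // => i _.
by rewrite -scalemxAl -scalemxAr h scaler0.
Qed.

(** Every slice is fixed by [P] on both sides, so [M] may be replaced by P M P in its pairing with a
    slice. The product bound on traces then applies, and the trace of [slice v] is the form of rho_B
    at [v]. *)
Lemma outcomeB_le (P M : 'M[C]_a) : psdmx M -> P^t* = P -> P *m P = P ->
  reducedA rho *m P = reducedA rho ->
  lemx (outcomeB M) (\tr (P *m M) *: reducedB rho).
Proof.
move=> pM hP PP rP; rewrite /lemx.
have pPMP : psdmx (P *m M *m P) by have := psdmx_conj P pM; rewrite hP.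
have trP : \tr (P *m M *m P) = \tr (P *m M).
  by rewrite mxtrace_mulC mulmxA PP.
have t0 : 0 <= \tr (P *m M) by rewrite -trP; apply: psdmx_trace_ge0.
have [/hermsymmxP hM _] := psdmx_outcomeB pM.
have [/hermsymmxP hB _] : psdmx (\tr (P *m M) *: reducedB rho).
  by apply: psdmxZ => //; rewrite reducedB_outcomeB; apply/psdmx_outcomeB/psdmx1.
split; first by apply/hermsymmxP; rewrite linearB /= map_mxB hM hB.
move=> v; rewrite mulmxBr mulmxBl -scalemxAr -scalemxAl reducedB_outcomeB.
rewrite mxE [X in X + _]mxE [X in _ + X]mxE !outcomeB_form mul1mx subr_ge0.
(* This is [slice_kernel] for Q = 1 - P, which rho_A annihilates. *)
have SP : slice v *m P = slice v.
  apply/eqP; rewrite -subr_eq0 -{2}[slice v]mulmx1 -mulmxBr -oppr_eq0 -mulmxN opprB.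
  by apply/eqP/slice_kernel; rewrite mulmxBr mulmx1 rP subrr.
have PS : P *m slice v = slice v.
  have /hermsymmxP hS := (psdmx_slice v).1.
  by rewrite -{1}hS -hP -trmxC_mul SP hS.
have -> : \tr (M *m slice v) = \tr (P *m M *m P *m slice v).
  by rewrite -!mulmxA PS [RHS]mxtrace_mulC -mulmxA SP.
by rewrite -trP; case/andP: (psdmx_trace_mul pPMP (psdmx_slice v)).
Qed.

End Bipartite.

(** * The least multiple of one operator that dominates another *)

Section MinimalWeight.
Set Implicit Arguments.
Unset Strict Implicit.
Variables (R : realType) (n : nat).
Implicit Types T Y : 'M[R[i]]_n.

(** Requiring c >= 0 keeps the set bounded below even when [Y] is 0. Feasibility of some c is
    assumed in the lemmas below, which keeps the infimum from being that of an empty set. *)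
Definition minweight T Y : R := inf [set c : R | 0 <= c /\ lemx T (c%:C *: Y)]%classic.

Lemma minweight_le T Y c : 0 <= c -> lemx T (c%:C *: Y) -> minweight T Y <= c.
Proof. by move=> c0 hc; apply: ge_inf => //; exists 0 => d []. Qed.

Lemma minweight_ge0 T Y c : 0 <= c -> lemx T (c%:C *: Y) -> 0 <= minweight T Y.
Proof. by move=> c0 hc; apply: lb_le_inf; [exists c | move=> d []]. Qed.

Lemma lemx_weight_mono T Y (c d : R) : psdmx Y -> c <= d ->
  lemx T (c%:C *: Y) -> lemx T (d%:C *: Y).
Proof.
move=> pY cd hc; rewrite /lemx.
have -> : d%:C *: Y - T = (d - c)%:C *: Y + (c%:C *: Y - T).
  by rewrite rmorphB scalerBl addrA subrK.
by apply: psdmxD => //; apply: psdmxZ => //; rewrite ler0c subr_ge0.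
Qed.

(* For each vector the constraint on c is a closed half-line, so the infimum
   over c is attained. *)
Lemma lemx_minweight T Y c : psdmx T -> psdmx Y -> 0 <= c ->
  lemx T (c%:C *: Y) -> lemx T ((minweight T Y)%:C *: Y).
Proof.
move=> [/hermsymmxP hT pT] pY c0 hc.
have pZ := psdmxZ _ pY; have [/hermsymmxP hZ _] : psdmx ((minweight T Y)%:C *: Y).
  by apply: pZ; rewrite ler0c; apply: minweight_ge0 hc.
split; first by apply/hermsymmxP; rewrite linearB /= map_mxB hZ hT.
have formE (d : R) (v : 'cV_n) : (v^t* *m (d%:C *: Y - T) *m v) 0 0 =
    d%:C * (v^t* *m Y *m v) 0 0 - (v^t* *m T *m v) 0 0.
  by rewrite mulmxBr mulmxBl -scalemxAr -scalemxAl mxE [X in X + _]mxE [X in _ + X]mxE.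
move=> v; rewrite formE subr_ge0.
have := pY.2 v; have := pT v.
set t := (_ *m T *m v) 0 0; set y := (_ *m Y *m v) 0 0 => t0 y0.
have h d : 0 <= d -> lemx T (d%:C *: Y) -> complex.Re t <= d * complex.Re y.
  move=> d0 [_ /(_ v)]; rewrite formE subr_ge0 -/t -/y.
  by rewrite -(RRe_real (ger0_real t0)) -(RRe_real (ger0_real y0)) -rmorphM lecR.
have : 0 <= complex.Re y by rewrite -ler0c (RRe_real (ger0_real y0)).
rewrite -(RRe_real (ger0_real t0)) -(RRe_real (ger0_real y0)) -rmorphM lecR.
(* If the form of [Y] vanishes at [v], the constraint does not depend on the weight, and the
   feasible [c] settles it. Otherwise t / y is a lower bound of all feasible weights. *)
rewrite le_eqVlt => /predU1P[y00|ygt0].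
  by have := h c c0 hc; rewrite -y00 !mulr0.
rewrite -ler_pdivrMr //; apply: lb_le_inf; first by exists c.
by move=> d [d0 hd]; rewrite ler_pdivrMr //; apply: h.
Qed.

End MinimalWeight.

(** * Positivity of block-diagonal operators *)

Section ClassicalQuantum.
Set Implicit Arguments.
Unset Strict Implicit.
Variables (R : realType) (n b : nat).
Local Notation C := R[i].

Lemma psdmx_tens_delta (x : 'I_n) (Y : 'M[C]_b) :
  psdmx Y -> psdmx (tensmx (delta_mx x x) Y).
Proof.
move=> /psdmx_gram [G ->].
have -> : tensmx (delta_mx x x) (G^t* *m G) =
    (tensmx (delta_mx x x : 'M[C]_n) G)^t* *m 1%:M *m tensmx (delta_mx x x) G.
  by rewrite mulmx1 trmx_tens map_mxT trmx_delta map_delta_mx tensmx_mul mul_delta_mx.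
exact/psdmx_conj/psdmx1.
Qed.

Lemma psdmx_block_diag (Y : 'I_n -> 'M[C]_b) :
  psdmx (\sum_x tensmx (delta_mx x x) (Y x)) <-> forall x, psdmx (Y x).
Proof.
split=> [pY x|pY]; last by apply: psdmx_sum => x; apply: psdmx_tens_delta.
(* [V] is the isometry sending |i> to |x> (x) |i>; compressing by it extracts the block at [x]. *)
pose V : 'M[C]_(n * b, b) := \matrix_(s, i) (s == mxtens_index (x, i))%:R.
suff -> : Y x = V^t* *m (\sum_x tensmx (delta_mx x x) (Y x)) *m V by apply: psdmx_conj.
apply/matrixP => i j; rewrite mxE (bigD1 (mxtens_index (x, j))) //=.
rewrite [X in _ + X]big1 ?addr0 => [|s /negbTE sj]; last by rewrite !mxE sj mulr0.
rewrite [X in _ * X]mxE eqxx mulr1 mxE (bigD1 (mxtens_index (x, i))) //=.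
rewrite [X in _ + X]big1 ?addr0 => [|s /negbTE sj]; last first.
  by rewrite !mxE sj conjC0 mul0r.
rewrite !mxE eqxx conjC1 mul1r summxE (bigD1 x) //= [X in _ + X]big1 => [|y /negbTE yx].
  by rewrite tensmxE mxE !eqxx mul1r addr0.
by rewrite tensmxE mxE eq_sym yx mul0r.
Qed.

End ClassicalQuantum.

(** * Admissible exponents and the total weight of a POVM *)

Section Accessible.
Set Implicit Arguments.
Unset Strict Implicit.
Variables (R : realType) (a b : nat) (rho : 'M[R[i]]_(a * b)).
Local Notation C := R[i].

Lemma apply_measureE n (M : 'I_n -> 'M[C]_a) :
  apply_on_A (measure M) rho = \sum_x tensmx (delta_mx x x) (outcomeB rho (M x)).
Proof.
apply/matrixP => s t.
case: (mxtens_indexP s) => x i; case: (mxtens_indexP t) => y j.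
rewrite /apply_on_A !summxE (bigD1 i) //= [X in _ + X]big1 => [|k /negbTE ki].
  rewrite addr0 summxE (bigD1 j) //= [X in _ + X]big1 => [|k /negbTE kj].
    rewrite addr0 tensmxE summxE [X in _ * X]mxE !eqxx mulr1.
    by apply: eq_bigr => z _; rewrite tensmxE !mxE mulrC.
  by rewrite tensmxE [X in _ * X]mxE [j == k]eq_sym kj andbF mulr0.
rewrite summxE big1 // => l _.
by rewrite tensmxE [X in _ * X]mxE [i == k]eq_sym ki mulr0.
Qed.

Lemma lemx_apply_measure n (M : 'I_n -> 'M[C]_a) (lambda : 'I_n -> R) (c : R) :
  lemx (apply_on_A (measure M) rho)
    (c%:C *: tensmx (\sum_x (lambda x)%:C *: delta_mx x x) (reducedB rho)) <->
  forall x, lemx (outcomeB rho (M x)) ((c * lambda x)%:C *: reducedB rho).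
Proof.
rewrite -psdmx_block_diag /lemx apply_measureE.
suff -> : c%:C *: tensmx (\sum_x (lambda x)%:C *: delta_mx x x) (reducedB rho)
    - \sum_x tensmx (delta_mx x x) (outcomeB rho (M x)) =
  \sum_x tensmx (delta_mx x x)
     ((c * lambda x)%:C *: reducedB rho - outcomeB rho (M x)) by [].
apply/matrixP => s t.
case: (mxtens_indexP s) => x i; case: (mxtens_indexP t) => y j.
rewrite mxE [X in X + _]mxE tensmxE summxE [X in _ + X]mxE !summxE.
rewrite mulr_suml mulr_sumr -sumrB; apply: eq_bigr => z _.
rewrite !tensmxE [X in _ * (X * _)]mxE [X in _ = _ * X]mxE.
rewrite [X in _ = _ * (X + _)]mxE [X in _ = _ * (_ + X)]mxE.
by rewrite rmorphM mulrBr; congr (_ - _); ring.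
Qed.

Hypothesis rho_density : density rho.

Definition total_weight n (M : 'I_n -> 'M[C]_a) : R :=
  \sum_x minweight (outcomeB rho (M x)) (reducedB rho).

Lemma psdmx_reducedB : psdmx (reducedB rho).
Proof. by rewrite reducedB_outcomeB; apply: (psdmx_outcomeB rho_density.1 (psdmx1 _ _)). Qed.

(** [P] is chosen before [M], so that a single projector serves all outcomes of a POVM and the
    bounds can be summed. The trace is complex, hence its presentation as a real [c]. *)
Lemma outcome_weight_bound : exists P : 'M[C]_a,
  \tr P = (\rank (reducedA rho))%:R /\
  forall M, psdmx M -> exists c : R,
    [/\ c%:C = \tr (P *m M), 0 <= c & lemx (outcomeB rho M) (c%:C *: reducedB rho)].
Proof.
have [P [hP PP rP trP]] := support_proj (reducedA rho); exists P; split=> // M pM.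
have pP : psdmx P by have := psdmx_conj P (psdmx1 _ _); rewrite hP mulmx1 PP.
have t0 : 0 <= \tr (P *m M) by case/andP: (psdmx_trace_mul pP pM).
have e := RRe_real (ger0_real t0); exists (complex.Re (\tr (P *m M))).
split; rewrite ?e //; first by rewrite -ler0c e.
exact: (outcomeB_le rho_density.1).
Qed.

Lemma outcome_minweight M (c := minweight (outcomeB rho M) (reducedB rho)) :
  psdmx M -> 0 <= c /\ lemx (outcomeB rho M) (c%:C *: reducedB rho).
Proof.
move=> pM; have [P [_ /(_ M pM) [d [_ d0 hd]]]] := outcome_weight_bound.
split; first exact: minweight_ge0 hd.
exact: (lemx_minweight (psdmx_outcomeB rho_density.1 pM) psdmx_reducedB d0 hd).
Qed.

(** Besides bounding the exponents below, this makes the total weight positive, so that one may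
    divide by it and take its logarithm. *)
Lemma total_weight_ge1 n (M : 'I_n -> 'M[C]_a) : povm M -> 1 <= total_weight M.
Proof.
move=> [pM sM]; rewrite -lecR /total_weight rmorph_sum /=.
have trB : \tr (reducedB rho) = 1 by rewrite trace_reducedB rho_density.2.
have -> : 1%:C = \sum_x \tr (outcomeB rho (M x)).
  by rewrite -raddf_sum /= outcomeB_sum sM -reducedB_outcomeB trB.
apply: ler_sum => x _; have [_ h] := outcome_minweight (pM x).
by have := psdmx_trace_ge0 h; rewrite raddfB /= mxtraceZ trB mulr1 subr_ge0.
Qed.

Lemma total_weight_le_rank n (M : 'I_n -> 'M[C]_a) : povm M ->
  total_weight M <= (\rank (reducedA rho))%:R.
Proof.
move=> [pM sM]; have [P [trP hP]] := outcome_weight_bound.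
(* Expanding 1 as the sum of the [M x] splits the trace of [P] into one term per outcome. *)
rewrite -lecR /total_weight rmorph_sum rmorph_nat -trP -[P in \tr P]mulmx1.
rewrite -sM mulmx_sumr raddf_sum.
apply: ler_sum => x _; have [c [cE c0 hc]] := hP _ (pM x); rewrite /= -cE.
by rewrite lecR; apply: minweight_le.
Qed.

Lemma acc_bound_total_weight (r : R) :
  acc_bound rho r <->
  forall n (M : 'I_n -> 'M[C]_a), povm M -> total_weight M <= 2 `^ r.
Proof.
split=> h n M pM.
  have [_ [[lambda [[l0 l1] ->]] /lemx_apply_measure hl]] := h n M pM.
  (* The weights 2^r lambda_x are feasible and sum to 2^r, so they dominate the least weights term
     by term. *)
  rewrite (_ : 2 `^ r = \sum_x 2 `^ r * lambda x); last by rewrite -mulr_sumr l1 mulr1.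
  apply: ler_sum => x _.
  by apply: minweight_le (hl x); rewrite mulr_ge0 ?powR_ge0.
pose w x := minweight (outcomeB rho (M x)) (reducedB rho).
have W0 : 0 < total_weight M by apply: lt_le_trans (total_weight_ge1 pM).
(* The distribution is that of the normalised least weights; 2^r times it dominates [w] because the
   total weight is at most 2^r. *)
exists (\sum_x (w x / total_weight M)%:C *: delta_mx x x); split.
  exists (fun x => w x / total_weight M); split=> //; split=> [x|].
    by rewrite divr_ge0 ?(ltW W0) //; case: (outcome_minweight (pM.1 x)).
  by rewrite -mulr_suml divff ?gt_eqF.
apply/lemx_apply_measure => x.
have [w0 hw] := outcome_minweight (pM.1 x).
apply: lemx_weight_mono hw; first exact: psdmx_reducedB.
by rewrite mulrCA ler_peMr // ler_pdivlMr // mul1r h.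
Qed.

End Accessible.

(** * Passage to logarithms and the infimum over exponents *)

Lemma le_pow2 (R : realType) (s r : R) : 0 < s -> (s <= 2 `^ r) = (ln s / ln 2 <= r).
Proof.
move=> s0; rewrite -ler_ln ?posrE ?powR_gt0 // ln_powR ler_pdivrMr //.
by rewrite ln_gt0 // ltr1n.
Qed.

Theorem proposition1 (R : realType) (dA dB : nat) (rho : 'M[R[i]]_(dA * dB))
    (rho_density : density rho) :
  exists I : R, is_Imax_acc rho I /\ I <= H0 rho.
Proof.
have W0 n (M : 'I_n -> 'M[R[i]]_dA) : povm M -> 0 < total_weight rho M.
  by move=> pM; apply: lt_le_trans (total_weight_ge1 rho_density pM).
have accP r : acc_bound rho r <-> forall n (M : 'I_n -> 'M[R[i]]_dA), povm M ->
    ln (total_weight rho M) / ln 2 <= r.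
  rewrite acc_bound_total_weight //.
  by split=> h n M pM; have := h n M pM; rewrite le_pow2 ?W0.
have bounded_below : has_lbound (acc_bound rho).
  (* The trivial one-outcome POVM already bounds every admissible exponent below. *)
  exists (ln (total_weight rho (fun _ : 'I_1 => 1%:M)) / ln 2) => r /accP; apply.
  by split=> [_|]; [exact: psdmx1 | rewrite big_ord1].
have accH0 : acc_bound rho (H0 rho).
  apply/accP => n M pM; rewrite ler_pM2r ?invr_gt0 ?ln_gt0 ?ltr1n //.
  rewrite ler_ln ?posrE ?W0 ?total_weight_le_rank //.
  (* Comparing logarithms requires a positive rank, which holds because the rank dominates a
     positive total weight. *)
  exact: lt_le_trans (W0 _ _ pM) (total_weight_le_rank rho_density pM).
exists (inf (acc_bound rho)); split; last exact: ge_inf.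
split; last by move=> r; apply: ge_inf.
(* The infimum is itself admissible: each POVM gives a lower bound of the admissible set, which
   contains [H0 rho]. *)
apply/accP => n M pM; apply: lb_le_inf; first by exists (H0 rho).
by move=> r /accP; apply.
Qed.
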